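(* Let $X$ be a (real) Banach lattice. Suppose that there exists a constant $c$ with $0 < c < 2$ such that $$c\,\|x + y\| \ge \|x\| + \|y\|$$ for all disjoint $x, y \in X$. Then $X$ satisfies a lower $p$-estimate for some $1 \le p < \infty$.
   Context: Two elements $x,y$ of a Banach lattice are disjoint if $|x| \wedge |y| = 0$. For $1 \le p < \infty$, a Banach lattice $X$ satisfies a lower $p$-estimate if there is a constant $C < \infty$ such that for every finite family $(x_i)_{1\le i\le n}$ of pairwise disjoint elements of $X$, $\big(\sum_{i} \|x_i\|^p\big)^{1/p} \le C\,\|\sum_{i} x_i\|$. *)

(* Defs.v *)
From HB Require Import structures.
From mathcomp Require Import all_boot all_order all_algebra.
From mathcomp Require Import all_classical all_reals all_analysis.

Set Implicit Arguments.
Unset Strict Implicit.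
Unset Printing Implicit Defensive.

Import Order.TTheory GRing.Theory Num.Theory.
Import numFieldNormedType.Exports.

Local Open Scope ring_scope.

(* A structure inheriting from both a lattice and a normed module cannot be
   declared downstream of [realDomainType], so the order and the lattice
   operations are mixin fields, and every vector lattice is then made an instance
   of [latticeType]. That order is written in [order_scope] (delimiter [%O]). *)
Fact riesz_display : Order.disp_t. Proof. exact: Order.Disp tt tt. Qed.

HB.mixin Record Lmodule_isRiesz (R : numDomainType) X of GRing.Lmodule R X := {
  rle : rel X ;
  rmeet : X -> X -> X ;
  rjoin : X -> X -> X ;
  rle_refl : reflexive rle ;
  rle_anti : antisymmetric rle ;
  rle_trans : transitive rle ;
  rmeetP : forall x y z : X, rle x (rmeet y z) = rle x y && rle x z ;
  rjoinP : forall x y z : X, rle (rjoin x y) z = rle x z && rle y z ;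
  rle_addr : forall x y z : X, rle x y -> rle (x + z) (y + z) ;
  rle_scale : forall (a : R) (x y : X), 0 <= a -> rle x y -> rle (a *: x) (a *: y)
}.

#[short(type="rieszType")]
HB.structure Definition Riesz (R : numDomainType) :=
  { X of GRing.Lmodule R X & Lmodule_isRiesz R X }.

HB.instance Definition _ (R : numDomainType) (X : rieszType R) :=
  Order.Le_isPOrder.Build riesz_display (Riesz.sort X)
    (@rle_refl R X) (@rle_anti R X) (@rle_trans R X).

HB.instance Definition _ (R : numDomainType) (X : rieszType R) :=
  Order.POrder_MeetJoin_isLattice.Build riesz_display (Riesz.sort X)
    (@rmeetP R X) (@rjoinP R X).

(* The lattice-valued absolute value of a vector; the notation [`|x|] is its
   norm. *)
Definition modulus (R : numDomainType) (X : rieszType R) (x : X) : X :=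
  (x `|` (- x))%O.

Definition disjointv (R : numDomainType) (X : rieszType R) (x y : X) : Prop :=
  (modulus x `&` modulus y)%O = 0.

HB.mixin Record Riesz_CompleteNormed_isBanachLattice (R : realType) X
    of Riesz R X & CompleteNormedModule R X := {
  ler_norm_modulus : forall x y : X,
    (modulus x <= modulus y)%O -> `|x| <= `|y|
}.

#[short(type="banachLatticeType")]
HB.structure Definition BanachLattice (R : realType) :=
  { X of Riesz R X & CompleteNormedModule R X &
         Riesz_CompleteNormed_isBanachLattice R X }.

HB.instance Definition _ (R : realType) (X : banachLatticeType R) :=
  Order.Lattice.copy (BanachLattice.sort X) (Riesz.sort X).

(* At [n = 0] both sides vanish: [0 `^ p^-1 = 0] for [p != 0]. *)
Definition lower_estimate (R : realType) (X : banachLatticeType R) (p : R) :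
    Prop :=
  exists C : R, forall (n : nat) (x : 'I_n -> X),
    (forall i j : 'I_n, i != j -> disjointv (x i) (x j)) ->
    (\sum_(i < n) `|x i| `^ p) `^ p^-1 <= C * `|\sum_(i < n) x i|.

(* Main.v *)
Require Import Defs.
From HB Require Import structures.
From mathcomp Require Import all_boot all_order all_algebra.
From mathcomp Require Import all_classical all_reals all_analysis.
From mathcomp Require Import lra.

Set Implicit Arguments.
Unset Strict Implicit.
Unset Printing Implicit Defensive.

Import Order.TTheory GRing.Theory Num.Theory.
Import numFieldNormedType.Exports.

Local Open Scope ring_scope.

(* The hypothesis makes the smaller of two disjoint vectors have norm at most
   [c / 2] times that of their sum, with [c / 2 < 1]; fix [N] with
   [(c / 2) ^+ N <= 1/4]. For a disjoint family sorted by decreasing norm, pair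
   up neighbours: [x_1 + x_2, x_3 + x_4, ...]. Bounding both [|x_2k|^N] and
   [|x_(2k+1)|^N] by [|x_(2k-1) + x_2k|^N / 4] shows that the sum of the N-th
   powers of the norms is at most [|x_1|^N] plus half of the same sum for the
   paired family. That family is again disjoint, with the same total [S], and
   shorter; as [|x_1| <= c |S|], induction on the length bounds the sum by
   [2 (c |S|)^N]. *)

(** Lets disjointness survive the sorting of a family by norm. *)
Lemma perm_pairwise (T : eqType) (r : rel T) (s t : seq T) :
  symmetric r -> perm_eq s t -> pairwise r s -> pairwise r t.
Proof.
move=> r_sym; elim: t s => [|x t IHt] s // st.
have xs : x \in s by rewrite (perm_mem st) mem_head.
case/splitPr: xs st => s1 s2 st.
have {}st : perm_eq (s1 ++ s2) t.
  by rewrite -(perm_cons x) -(permPr st) perm_sym -cat1s perm_catCA.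
rewrite pairwise_cat allrel_consr pairwise_cons /=.
case/andP=> /andP[s1x s12] /and3P[rs1 xs2 rs2]; apply/andP; split.
  rewrite -(perm_all _ st) all_cat xs2 andbT.
  by rewrite (@eq_all _ _ (r^~ x)) // => y; exact: r_sym.
by apply: IHt st _; rewrite pairwise_cat s12 rs1.
Qed.

Section VectorLattice.
Variables (R : numFieldType) (X : rieszType R).
Implicit Types x y z : X.

Lemma lerD2r_riesz z x y : (x <= y)%O -> (x + z <= y + z)%O.
Proof. exact: rle_addr. Qed.

Lemma lerD_riesz x y z t : (x <= y)%O -> (z <= t)%O -> (x + z <= y + t)%O.
Proof.
move=> xy zt; apply: le_trans (lerD2r_riesz _ xy) _.
by rewrite ![y + _]addrC; exact: lerD2r_riesz.
Qed.

Lemma ler_modulus x : (x <= modulus x)%O.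
Proof. exact: leUl. Qed.

Lemma lerN_modulus x : (- x <= modulus x)%O.
Proof. exact: leUr. Qed.

Lemma modulus_ge0 x : ((0 : X) <= modulus x)%O.
Proof.
(* Adding [x <= modulus x] and [- x <= modulus x] gives [0 <= 2 modulus x], which is then halved. *)
have := lerD_riesz (ler_modulus x) (lerN_modulus x); rewrite subrr => h.
have half_ge0 : 0 <= (2^-1 : R) by rewrite invr_ge0.
have := @rle_scale R X 2^-1 _ _ half_ge0 h; rewrite scaler0.
suff -> : 2^-1 *: (modulus x + modulus x) = modulus x by [].
rewrite scalerDr -scalerDl -mulr2n -[_ *+ _]mulr_natr.
by rewrite mulVf ?scale1r ?pnatr_eq0.
Qed.

Lemma modulusD x y : (modulus (x + y) <= modulus x + modulus y)%O.
Proof.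
rewrite leUx opprD; apply/andP; split; apply: lerD_riesz;
  by [exact: ler_modulus|exact: lerN_modulus].
Qed.

Lemma modulus0 : modulus (0 : X) = 0.
Proof. by rewrite /modulus oppr0 joinxx. Qed.

Lemma disjointvC x y : disjointv x y -> disjointv y x.
Proof. by rewrite /disjointv meetC. Qed.

Lemma disjointv0 x : disjointv x 0.
Proof. by rewrite /disjointv modulus0; apply: meet_r; exact: modulus_ge0. Qed.

(** Let [u] be the meet of [modulus x] and [modulus (y + z)]. Then [u - modulus z] is below both
    [modulus x] and [modulus y], hence below [0]. So [u] is below both [modulus x] and [modulus z],
    whose meet is [0]. *)
Lemma disjointvD x y z :
  disjointv x y -> disjointv x z -> disjointv x (y + z).
Proof.
rewrite /disjointv => xy xz; set u := (_ `&` _)%O.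
have ux : (u <= modulus x)%O by exact: leIl.
have uyz : (u <= modulus y + modulus z)%O.
  by apply: le_trans (modulusD y z); exact: leIr.
suff u0 : (u <= (0 : X))%O by apply/le_anti; rewrite u0 lexI !modulus_ge0.
rewrite -xz lexI ux /=.
have : (u - modulus z <= (0 : X))%O.
  rewrite -xy lexI; apply/andP; split.
    apply: le_trans ux; rewrite -[leRHS]addr0; apply: lerD_riesz => //.
    have := lerD2r_riesz (- modulus z) (modulus_ge0 z).
    by rewrite subrr add0r.
  by have := lerD2r_riesz (- modulus z) uyz; rewrite addrK.
by move/(lerD2r_riesz (modulus z)); rewrite subrK add0r.
Qed.

Lemma disjointv_sum x (s : seq X) :
  {in s, forall y, disjointv x y} -> disjointv x (\sum_(y <- s) y).
Proof.
move=> h; rewrite big_seq_cond.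
apply: (big_ind (disjointv x)) => [|y z|y /andP[/h]] //.
  exact: disjointv0.
exact: disjointvD.
Qed.

End VectorLattice.

Fixpoint pair_sums (V : nmodType) (s : seq V) : seq V :=
  if s is [:: x, y & t] then x + y :: pair_sums t else s.

(** Induction in steps of two, matching the recursion of [pair_sums]. *)
Lemma list_ind2 (T : Type) (P : seq T -> Prop) :
  P [::] -> (forall x, P [:: x]) ->
  (forall x y s, P s -> P [:: x, y & s]) -> forall s, P s.
Proof.
move=> P0 P1 P2 s.
suff: P s /\ forall x, P (x :: s) by case.
by elim: s => [|y s [IHs IHys]]; split=> // x; exact: P2.
Qed.

Lemma size_pair_sums (V : nmodType) (s : seq V) :
  (size (pair_sums s) <= size s)%N.
Proof. by elim/list_ind2: s => //= x y s IHs; rewrite ltnS leqW. Qed.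

Lemma sum_pair_sums (V : nmodType) (s : seq V) :
  \sum_(x <- pair_sums s) x = \sum_(x <- s) x.
Proof. by elim/list_ind2: s => //= x y s IHs; rewrite !big_cons IHs addrA. Qed.

Section LowerEstimate.
Variables (R : realType) (X : banachLatticeType R).

(** Boolean form of disjointness, as required by [pairwise] and [all]. *)
Definition disjointb : rel X := fun x y => `[< disjointv x y >].

Lemma disjointb_sym : symmetric disjointb.
Proof. by move=> x y; apply/asboolP/asboolP; exact: disjointvC. Qed.

Lemma all_pair_sums (x : X) (s : seq X) :
  all (disjointb x) s -> all (disjointb x) (pair_sums s).
Proof.
elim/list_ind2: s => //= y z s IHs /and3P[/asboolP xy /asboolP xz /IHs ->].
by rewrite andbT; apply/asboolP; exact: disjointvD.
Qed.

Lemma pairwise_pair_sums (s : seq X) :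
  pairwise disjointb s -> pairwise disjointb (pair_sums s).
Proof.
elim/list_ind2: s => //= x y s IHs /and3P[/andP[_ xs] ys /IHs ->].
rewrite andbT; apply: all_pair_sums; apply/allP => z zs.
apply/asboolP/disjointvC/disjointvD; apply/disjointvC/asboolP.
  exact: (allP xs).
exact: (allP ys).
Qed.

Variable c : R.
Hypothesis c_ge0 : 0 <= c.
Hypothesis hc : forall x y : X, disjointv x y -> `|x| + `|y| <= c * `|x + y|.

(** The head is disjoint from the sum of the tail, so [hc] applies to these two vectors. *)
Lemma expr_norm_head_le (N : nat) (x : X) (s : seq X) :
  pairwise disjointb (x :: s) ->
  `|x| ^+ N <= (c * `|\sum_(y <- x :: s) y|) ^+ N.
Proof.
rewrite big_cons => /andP[/allP xs _].
have /hc : disjointv x (\sum_(y <- s) y).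
  by apply: disjointv_sum => y /xs /asboolP.
move=> h; apply: lerXn2r; rewrite ?nnegrE ?mulr_ge0 //.
by apply: le_trans h; rewrite lerDl.
Qed.

Variable N : nat.
Hypothesis hN : (c / 2) ^+ N <= 4^-1.

(** Since [2 |y| <= |x| + |y| <= c |x + y|], the N-th power of [|y|] gains the factor
    [(c / 2) ^+ N <= 1/4]. *)
Lemma expr_norm_le_half (x y : X) : disjointv x y -> `|y| <= `|x| ->
  `|y| ^+ N *+ 2 <= `|x + y| ^+ N / 2.
Proof.
move=> /hc xy yx.
have : `|y| <= c / 2 * `|x + y| by lra.
have t_ge0 : 0 <= c / 2 * `|x + y| by rewrite mulr_ge0 ?divr_ge0.
move/(lerXn2r N (normr_ge0 y : `|y| \is Num.nneg) t_ge0); rewrite exprMn.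
move=> /le_trans/(_ (ler_wpM2r (exprn_ge0 N (normr_ge0 _)) hN)).
rewrite -mulr_natr; move: (`|y| ^+ N) (`|x + y| ^+ N) => u v; lra.
Qed.

Lemma sum_expr_norm_pair_sums (s : seq X) :
  sorted (fun y z : X => `|z| <= `|y|) s -> pairwise disjointb s ->
  \sum_(y <- s) `|y| ^+ N <=
    `|head 0 s| ^+ N + (\sum_(y <- pair_sums s) `|y| ^+ N) / 2.
Proof.
have ge0 (z : X) : 0 <= `|z| ^+ N by exact: exprn_ge0.
elim/list_ind2: s => [|x|x y s IHs].
- by rewrite !big_nil mul0r addr0.
- by rewrite !big_seq1 /= lerDl divr_ge0.
move=> /= /andP[yx ys] /and3P[/andP[/asboolP xy _] _ s_disj].
have := expr_norm_le_half xy yx.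
have := IHs (path_sorted ys) s_disj.
(* Of the two copies of [|y| ^+ N] controlled by the pair, one pays for [y], the other for the head
   term left by the induction hypothesis. If [s] is empty, the default head [0] has the least
   norm. *)
have : `|head 0 s| ^+ N <= `|y| ^+ N.
  apply: lerXn2r; rewrite ?nnegrE //.
  by case: s ys {IHs s_disj} => [|z s] /=; [rewrite normr0|case/andP].
rewrite !big_cons -mulr_natr; lra.
Qed.

Lemma sum_expr_norm_le (s : seq X) : pairwise disjointb s ->
  \sum_(x <- s) `|x| ^+ N <= (c * `|\sum_(x <- s) x|) ^+ N *+ 2.
Proof.
have [n] := ubnP (size s); elim: n s => // n IHn s sn.
pose geN := fun y z : X => `|z| <= `|y|.
have geN_total : total geN by move=> y z; exact: le_total.
have {geN_total} := sort_sorted geN_total s.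
have ss : perm_eq s (sort geN s) by rewrite perm_sym perm_sort.
rewrite !(perm_big _ ss) /= => s_sorted /(perm_pairwise disjointb_sym ss).
move: (sort geN s) s_sorted (perm_size ss) sn => t t_sorted -> {s ss}.
move=> tn t_disj.
case: t tn t_sorted t_disj => [|x [|y t]] tn t_sorted t_disj.
- by rewrite big_nil mulrn_wge0 // exprn_ge0 // mulr_ge0.
- rewrite big_seq1; apply: le_trans (expr_norm_head_le N t_disj) _.
  by rewrite mulr2n lerDl exprn_ge0 // mulr_ge0.
apply: le_trans (sum_expr_norm_pair_sums t_sorted t_disj) _.
have h := expr_norm_head_le N t_disj.
have := IHn (pair_sums [:: x, y & t]); rewrite sum_pair_sums.
move=> /(_ _ (pairwise_pair_sums t_disj)).
(* Merging [x] and [y] already shortens the list by one. *)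
have sz : (size (pair_sums [:: x, y & t]) < n)%N.
  by apply: leq_ltn_trans _ (tn : (size t).+1 < n)%N; exact: size_pair_sums.
(* With [M = (c |S|) ^+ N], the head costs at most [M] and the paired family half of [2 M], so the
   bound [2 M] reproduces itself. *)
move=> /(_ sz); rewrite -mulr_natr /= in h *; lra.
Qed.

End LowerEstimate.

Lemma exists_expr_le (R : realType) (a e : R) : 0 <= a < 1 -> 0 < e ->
  exists2 n, (0 < n)%N & a ^+ n <= e.
Proof.
case/andP=> a0 a1 e0.
(* Reading the limit at [n.+1] makes the exponent positive. *)
have /cvgr0_norm_lt /(_ e e0) [n _ /(_ n.+1 (leqnSn n))] :
    (GRing.exp a n @[n --> \oo] --> (0 : R))%classic.
  by apply: cvg_expr; rewrite ger0_norm.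
by rewrite ger0_norm ?exprn_ge0 // => /ltW; exists n.+1.
Qed.

Theorem theorem3 (R : realType) (X : banachLatticeType R)
    (c : R) (c_gt0 : 0 < c) (c_lt2 : c < 2)
    (hc : forall x y : X, disjointv x y -> `|x| + `|y| <= c * `|x + y|) :
  exists2 p : R, 1 <= p & lower_estimate X p.
Proof.
have [||N N0 hN] := @exists_expr_le R (c / 2) 4^-1.
- by rewrite divr_ge0 ?ltW //= ltr_pdivrMr // mul1r.
- by rewrite invr_gt0.
exists N%:R; first by rewrite ler1n.
(* As [2 <= 2 ^+ N] for [N > 0], the bound [2 (c S) ^+ N] is at most [(2 c S) ^+ N], whose N-th root
   is [2 c S]. *)
exists (2 * c) => n x x_disj.
have x_pairwise : pairwise (@disjointb R X) [seq x i | i <- index_enum 'I_n].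
  rewrite pairwise_map; have := index_enum_uniq 'I_n; rewrite uniq_pairwise.
  by apply: sub_pairwise => i j /= ij; apply/asboolP; exact: x_disj.
have := sum_expr_norm_le (ltW c_gt0) hc hN x_pairwise.
rewrite !big_map.
have -> : \sum_(i < n) `|x i| ^+ N = \sum_(i < n) `|x i| `^ N%:R.
  by apply: eq_bigr => i _; rewrite powR_mulrn.
set S := `|\sum_(i < n) x i| => le_S.
have cS_ge0 : 0 <= c * S by rewrite mulr_ge0 ?normr_ge0 // ltW.
have c2S_ge0 : 0 <= 2 * c * S by rewrite -mulrA mulr_ge0.
have le_2S : \sum_(i < n) `|x i| `^ N%:R <= (2 * c * S) `^ N%:R.
  apply: le_trans le_S _; rewrite powR_mulrn // -mulrA.
  rewrite [leRHS]exprMn -mulr_natl ler_wpM2r ?exprn_ge0 //.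
  by rewrite -[leLHS]expr1 ler_eXn2l // ltr1n.
have N_neq0 : N%:R != 0 :> R by rewrite pnatr_eq0 -lt0n.
have N_inv_ge0 : 0 <= N%:R^-1 :> R by rewrite invr_ge0.
have := ge0_ler_powR N_inv_ge0 _ _ le_2S.
rewrite -[leRHS]powRrM mulfV // powRr1 //.
apply; rewrite nnegrE ?powR_ge0 //.
by apply: sumr_ge0 => i _; exact: powR_ge0.
Qed.
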